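(* (a) It holds that \[\mathcal{S}^{rev}=\left\{S\in \mathcal{S}^0 : M_0<\infty,\ I_0>-\infty,\ \limsup_{n\to\infty}S_n=M_\infty,\ \liminf_{n\to-\infty}S_n=I_{-\infty}\right\},\] where $M_\infty=\lim_{n\to\infty}M_n=\sup_{n\in\mathbb{Z}}S_n$ and $I_{-\infty}=\lim_{n\to-\infty}I_n=\inf_{n\in\mathbb{Z}}S_n$. (b) For each choice of sign $\pm$ define \[\mathcal{S}_{sub-critical}^{\pm}=\left\{S\in \mathcal{S}^{0} : \lim_{n\to\pm\infty}\frac{S_n}{F(n)}=1\text{ for some strictly increasing function }F:\mathbb{Z}\to\mathbb{R}\right\},\] \[\mathcal{S}_{critical}^{\pm}=\left\{S\in \mathcal{S}^{0} : \sup_{n\in\mathbb{Z}}(M_n-I_n)=\limsup_{n\to\pm\infty}S_n-\liminf_{n\to\pm\infty}S_n=K\text{ for some }K\in \mathbb{N}\right\}.\] Then \[\mathcal{S}^{inv}=\bigcup_{*_1,*_2\in\{sub-critical,\,critical\}}\left(\mathcal{S}_{*_1}^-\cap\mathcal{S}_{*_2}^+\right),\] and moreover \[\mathcal{S}_{critical}^{\pm}=\left\{S\in \mathcal{S}^{0} : \sup_{n\in\mathbb{Z}}(M_n-S_n)<\infty,\ \limsup_{n \to \pm \infty}S_n= \liminf_{n \to \pm \infty}S_n + \sup_{n\in\mathbb{Z}}(M_n-S_n) \in \mathbb{R}\right\}.\] Furthermore, any $F$ for which the condition in the definition of $\mathcal{S}_{sub-critical}^{\pm}$ holds for some $S\in\mathcal{S}^0$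 is necessarily divergent as $n\to\pm\infty$ (with the corresponding sign).
   Context: $\mathbb{N}=\{1,2,\dots\}$. Let $\mathcal{S}^0=\{S:\mathbb{Z}\to\mathbb{Z} : S_0=0,\ |S_n-S_{n-1}|=1\ \forall n\in\mathbb{Z}\}$. For $S\in\mathcal{S}^0$ let $M_n=\sup_{m\le n}S_m$ and $I_n=\inf_{m\ge n}S_m$ (values in the extended reals; finiteness of $M_n$, resp. $I_n$, does not depend on $n$). The path $TS$ is well-defined iff $M_0<\infty$, and then $(TS)_n=2M_n-S_n-2M_0$; the path $T^{-1}S$ is well-defined iff $I_0>-\infty$, and then $(T^{-1}S)_n=2I_n-S_n-2I_0$. (Here $T^{-1}$ is just the name of this second map; both maps take values in $\mathcal{S}^0$.) Define \[\mathcal{S}^{rev}=\{S\in \mathcal{S}^0 : TS,\ T^{-1}S,\ T^{-1}TS,\ TT^{-1}S\text{ well-defined},\ T^{-1}TS=S,\ TT^{-1}S=S\},\] \[\mathcal{S}^{inv}=\{S\in \mathcal{S}^{0} : T^kS\in \mathcal{S}^{rev}\text{ for all }k\in\mathbb{Z}\},\] where $T^k$ for $k\ge0$ is the $k$-fold iterate of $T$, $T^{k}$ for $k<0$ is the $|k|$-fold iterate of $T^{-1}$, and membership of $T^kS$ includes the requirement that it is well-defined. *)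

(* Defs.v *)
From HB Require Import structures.
From mathcomp Require Import all_boot all_order all_algebra.
From mathcomp Require Import all_classical all_reals all_analysis.

Set Implicit Arguments.
Unset Strict Implicit.
Unset Printing Implicit Defensive.

Import Order.TTheory GRing.Theory Num.Theory.
Import numFieldNormedType.Exports.

Local Open Scope classical_set_scope.
Local Open Scope ring_scope.

Definition paths0 : set (int -> int) :=
  [set S | S 0 = 0 /\ forall n, `|S n - S (n - 1)| = 1].

Section pitman_transform.
Variable R : realType.
Implicit Types (S : int -> int) (n : int).

Definition embed S n : \bar R := ((S n)%:~R)%:E.

Definition M_ S n : \bar R := ereal_sup [set embed S m | m in [set m | m <= n]].

Definition I_ S n : \bar R := ereal_inf [set embed S m | m in [set m | n <= m]].

(* Since S takes integer values, a finite M_n or I_n is an integer, and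
   `Num.floor (fine _)` recovers it exactly: see floor_M and floor_I below. *)
Definition floorM S n : int := Num.floor (fine (M_ S n)).

Definition floorI S n : int := Num.floor (fine (I_ S n)).

Lemma floor_M S n : M_ S n \is a fin_num -> ((floorM S n)%:~R)%:E = M_ S n.
Proof.
move=> Mfin; have [_ [m mn <-] ltm] := ub_ereal_sup_adherent (@ltr01 R) Mfin.
have ubM k : k <= n -> (embed S k <= M_ S n)%E.
  by move=> nk; apply: ereal_sup_ubound; exists k.
suff Em : M_ S n = embed S m by rewrite /floorM Em /= intrKfloor.
apply/eqP; rewrite eq_le ubM// andbT; apply: ge_ereal_sup => _ [k kn <-].
have : (embed S k < embed S m + 1)%E.
  by rewrite (le_lt_trans (ubM _ kn))// -lteBlDr.
by rewrite -EFinD lte_fin lee_fin -(intrD _ _ 1) ltr_int ler_int ltzD1.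
Qed.

Lemma floor_I S n : I_ S n \is a fin_num -> ((floorI S n)%:~R)%:E = I_ S n.
Proof.
move=> Ifin; have [_ [m mn <-] ltm] := lb_ereal_inf_adherent (@ltr01 R) Ifin.
have lbI k : n <= k -> (I_ S n <= embed S k)%E.
  by move=> nk; apply: ereal_inf_lbound; exists k.
suff Em : I_ S n = embed S m by rewrite /floorI Em /= intrKfloor.
apply/eqP; rewrite eq_le lbI//=; apply: le_ereal_inf_tmp => _ [k kn <-].
have : (embed S m < embed S k + 1)%E.
  by rewrite (lt_le_trans ltm)// leeD2r// lbI.
by rewrite -EFinD lte_fin lee_fin -(intrD _ _ 1) ltr_int ler_int ltzD1.
Qed.

(* The partial maps T and T^{-1}: None means that the path is not
   well-defined. *)
Definition pitman S : option (int -> int) :=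
  if (M_ S 0 < +oo)%E
  then Some (fun n => 2 * floorM S n - S n - 2 * floorM S 0)
  else None.

Definition pitman_inv S : option (int -> int) :=
  if (-oo < I_ S 0)%E
  then Some (fun n => 2 * floorI S n - S n - 2 * floorI S 0)
  else None.

Definition pitman_iter (k : int) S : option (int -> int) :=
  match k with
  | Posz j => iter j (obind pitman) (Some S)
  | Negz j => iter j.+1 (obind pitman_inv) (Some S)
  end.

Definition Srev : set (int -> int) :=
  [set S | [/\ paths0 S, isSome (pitman S), isSome (pitman_inv S),
               obind pitman_inv (pitman S) = Some S
             & obind pitman (pitman_inv S) = Some S]].

Definition Sinv : set (int -> int) :=
  [set S | paths0 S /\ forall k : int,
     exists2 S', pitman_iter k S = Some S' & Srev S'].

End pitman_transform.

Variant sign := minus | plus.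

Variant regime := sub_critical | critical.

(* n -> +oo or n -> -oo in the integers is k -> oo along k |-> toward s k. *)
Definition toward (s : sign) (k : nat) : int :=
  match s with plus => k%:Z | minus => - k%:Z end.

Section classes.
Variable R : realType.
Implicit Types (S : int -> int) (s : sign).

Definition limsup s S : \bar R := limn_esup (embed R S \o toward s).

Definition liminf s S : \bar R := limn_einf (embed R S \o toward s).

Definition Moo S : \bar R := lim ((M_ R S \o toward plus) @ \oo).

Definition Ioo S : \bar R := lim ((I_ R S \o toward minus) @ \oo).

Definition strictly_increasing (F : int -> R) := {homo F : m n / m < n}.

Definition asymptotic_to s S (F : int -> R) :=
  (S (toward s k))%:~R / F (toward s k) @[k --> \oo] --> (1 : R).

Definition Ssub_critical s : set (int -> int) :=
  [set S | paths0 S /\ exists2 F, strictly_increasing F & asymptotic_to s S F].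

(* In each extended-real difference the first term is > -oo and the second is
   < +oo, except limsup - liminf, which is finite only if both terms are. *)
Definition Scritical s : set (int -> int) :=
  [set S | paths0 S /\ exists2 K : nat, (0 < K)%N &
    ereal_sup (range (fun n => M_ R S n - I_ R S n)%E)
      = (limsup s S - liminf s S)%E /\
    (limsup s S - liminf s S)%E = K%:R%:E].

Definition Sclass (c : regime) s : set (int -> int) :=
  match c with
  | sub_critical => Ssub_critical s
  | critical => Scritical s
  end.

End classes.

(* Main.v *)
Require Import Defs.
From mathcomp Require Import all_boot all_order all_algebra.
From mathcomp Require Import all_classical all_reals all_analysis.
From mathcomp Require Import zify ring lra.

Set Implicit Arguments.
Unset Strict Implicit.
Unset Printing Implicit Defensive.

Import Order.TTheory GRing.Theory Num.Theory.
Import numFieldNormedType.Exports.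

Local Open Scope classical_set_scope.
Local Open Scope ring_scope.

(* The reflection S_n |-> - S_(-n) exchanges T with T^-1 and the two ends of
   the path, so everything is done at the end n -> +oo. If limsup S = sup S,
   then the future infimum of TS is M - 2 M_0, which makes T^-1 T the identity;
   conversely T^-1 T S = S forces S to climb back to M_n after time n.

   Let S be in S^inv. If S is unbounded above and (M - S) / M >= 1 / a
   infinitely often, then for U = T^-1 S, looked at where S attains its maximum,
   M - U is at least the old M - S and the new maximum is at most the old S, so
   that the ratio of U is at least 1 / (a - 1) infinitely often; iterating gives
   a contradiction. Hence S ~ M, which is made strictly increasing by adding
   n / (1 + |n|). If S is bounded above, with limsup L and liminf l, and
   S_m - S_p > L - l for some m <= p, then T yields a drop at least as deep that
   starts strictly closer to the maximum of the path, again a contradiction after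
   finitely many steps. Conversely both kinds of ends are preserved by T and
   T^-1. *)

(** * Integer paths, reflection and running maxima *)

Definition flip (V : zmodType) (S : int -> V) : int -> V := fun n => - S (- n).

Lemma flipK (V : zmodType) : involutive (@flip V).
Proof. by move=> S; apply/funext => n; rewrite /flip !opprK. Qed.

Definition is_max (S f : int -> int) :=
  forall n : int, (forall m : int, m <= n -> S m <= f n) /\
    (exists2 m : int, m <= n & S m = f n).

Definition bounded_past (S : int -> int) :=
  exists b : int, forall m : int, m <= 0 -> S m <= b.

(** Order-theoretic form of limsup S = sup S at +oo; it covers the case where both sides are +oo. *)
Definition recovers (S : int -> int) :=
  forall m n : int, exists2 q : int, n <= q & S m <= S q.

(* Since flip exchanges suprema over the past and infima over the future,
   [is_max (flip S) (flip g)] says that g is the future infimum I of S, and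
   [is_pitman (flip S) (flip S')] says that S' = T^-1 S. *)
Definition is_pitman (S S' : int -> int) :=
  exists2 f, is_max S f & S' = fun n => 2 * f n - S n - 2 * f 0.

(** Combinatorial form of [Srev]: the two [recovers] clauses replace T^-1 T S = S and T T^-1 S =
    S. *)
Definition reversible (S : int -> int) :=
  [/\ paths0 S, bounded_past S, bounded_past (flip S), recovers S
    & recovers (flip S)].

Lemma int_ind_up (P : int -> Prop) (n : int) :
  P n -> (forall m : int, n <= m -> P m -> P (m + 1)) ->
  forall m : int, n <= m -> P m.
Proof.
move=> Pn PS m nm; have -> : m = n + `|m - n|%N by lia.
elim: `|m - n|%N => [|k IH]; first by rewrite addr0.
have -> : n + k.+1 = n + k + 1 by lia.
by apply: PS => //; lia.
Qed.

Lemma pathsS S (n : int) : paths0 S ->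
  S (n + 1) = S n + 1 \/ S (n + 1) = S n - 1.
Proof. by move=> [_ /(_ (n + 1))]; rewrite addrK; lia. Qed.

Lemma flip_paths0 S : paths0 S -> paths0 (flip S).
Proof.
move=> [S0 SS]; split => [|n]; first by rewrite /flip oppr0 S0.
rewrite /flip; have := SS (1 - n).
have -> : 1 - n - 1 = - n by lia.
have -> : - (n - 1) = 1 - n by lia.
by move: (S (1 - n)) (S (- n)) => a b; lia.
Qed.

(** Discrete intermediate value theorem: unit steps cannot jump over c. The induction says that by
    time q the level has been hit, or the path has stayed strictly below it. *)
Lemma first_passage S (n q c : int) : paths0 S ->
  n <= q -> S n <= c -> c <= S q ->
  exists r : int,
    [/\ n <= r, S r = c & forall m : int, n <= m -> m <= r -> S m <= c].
Proof.
move=> pS nq Sn cq.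
suff : forall q : int, n <= q ->
    (exists r : int,
      [/\ n <= r, S r = c & forall m : int, n <= m -> m <= r -> S m <= c])
    \/ (forall m : int, n <= m -> m <= q -> S m < c).
  by case/(_ q nq) => // /(_ q nq (lexx _)); lia.
move=> {cq q nq}; apply: int_ind_up.
  have [e|ne] := eqVneq (S n) c.
    left; exists n; split => // m nm mn.
    by rewrite (_ : m = n) ?e //; lia.
  by right => m nm mn; rewrite (_ : m = n) //; lia.
move=> q nq [|lt]; first by left.
have [e|ne] := eqVneq (S (q + 1)) c.
  left; exists (q + 1); split => // [|m nm mq]; first by lia.
  have [->|?] := eqVneq m (q + 1); first by lia.
  by apply: ltW; apply: lt => //; lia.
right => m nm mq.
have [->|?] := eqVneq m (q + 1); last by apply: lt => //; lia.
by have := lt q nq (lexx _); have := pathsS q pS; lia.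
Qed.

(** Every strict improvement lowers the gap b - f i by at least 1, so improvements must stop. *)
Lemma int_max (I : Type) (A : I -> Prop) (f : I -> int) (b : int) i0 :
  A i0 -> (forall i, A i -> f i <= b) ->
  exists2 i, A i & forall j, A j -> f j <= f i.
Proof.
move=> A0 fb.
have [k] : exists k : nat, b - f i0 <= k%:Z by exists `|b - f i0|%N; lia.
elim: k i0 A0 => [|k IH] i Ai bk.
  by exists i => // j /fb; lia.
have [[j [Aj fij]]|no] := pselect (exists j, A j /\ f i < f j).
  by apply: (IH j Aj); lia.
by exists i => // j Aj; case: leP => // ?; case: no; exists j.
Qed.

Lemma is_max_exists S : bounded_past S -> exists f, is_max S f.
Proof.
move=> [b Sb].
have bd (n : int) : exists c : int, forall m : int, m <= n -> S m <= c.
  have [n0|n0] := leP n 0.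
    by exists b => m mn; apply: Sb; lia.
  suff: forall n : int, 0 <= n ->
      exists c : int, forall m : int, m <= n -> S m <= c.
    by apply; lia.
  apply: int_ind_up; first by exists b.
  move=> m m0 [c Sc]; exists (Num.max c (S (m + 1))) => k km.
  have [->|?] := eqVneq k (m + 1); first by lia.
  by have := Sc k; lia.
have ex n : exists x : int,
    (forall m : int, m <= n -> S m <= x) /\ (exists2 m : int, m <= n & S m = x).
  have [c Sc] := bd n.
  have [m mn Sm] := @int_max _ (fun m => m <= n) S c n (lexx n) Sc.
  by exists (S m); split => //; exists m.
by exists (fun n => projT1 (cid (ex n))) => n; case: cid.
Qed.

Lemma is_max_bounded S f : is_max S f -> bounded_past S.
Proof. by move=> Sf; exists (f 0) => m m0; apply: (Sf 0).1. Qed.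

Lemma is_max_uniq S f g : is_max S f -> is_max S g -> f = g.
Proof.
move=> Sf Sg; apply/funext => n.
have [Sfn [m mn Em]] := Sf n; have [Sgn [k kn Ek]] := Sg n.
by have := Sfn k kn; have := Sgn m mn; lia.
Qed.

Lemma is_max_le S f (m n : int) : is_max S f -> m <= n -> f m <= f n.
Proof.
move=> Sf mn; have [_ [k km <-]] := Sf m; apply: (Sf n).1; lia.
Qed.

Lemma is_max_ge S f (n : int) : is_max S f -> S n <= f n.
Proof. by move=> Sf; apply: (Sf n).1. Qed.

(** * The transform and its inverse *)

Lemma is_pitman_exists S : bounded_past S -> exists S', is_pitman S S'.
Proof.
move=> /is_max_exists[f Sf]; by eexists; exists f.
Qed.

(** By [recovers] the path is back at height at least M_n after time n. At its first passage r
    through M_n nothing earlier is higher, so S_r = M_r = M_n. *)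
Lemma is_max_record S f (n : int) : paths0 S -> recovers S -> is_max S f ->
  exists2 q : int, n <= q & S q = f n /\ f q = f n.
Proof.
move=> pS rS Sf.
have [fn [m mn Sm]] := Sf n.
have [q nq] := rS m n; rewrite Sm => fq.
have [r [nr Sr rle]] := first_passage pS nq (is_max_ge n Sf) fq.
exists r => //; split=> //.
have [_ [k kr Ek]] := Sf r.
have := is_max_le Sf nr.
have [/fn|/ltW/rle/(_ kr)] := leP k n; lia.
Qed.

(** The future infimum of TS is M - 2 M_0: it is a lower bound because S <= M and M is
    nondecreasing, and it is attained at the times given by [is_max_record]. *)
Lemma pitman_min S f : paths0 S -> recovers S -> is_max S f ->
  is_max (flip (fun n => 2 * f n - S n - 2 * f 0))
    (flip (fun n => f n - 2 * f 0)).
Proof.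
move=> pS rS Sf n; split => [m mn|].
  have := is_max_le Sf (_ : - n <= - m); have := is_max_ge (- m) Sf.
  by rewrite /flip; lia.
have [q nq [Sq fq]] := is_max_record (- n) pS rS Sf.
by exists (- q); rewrite /flip ?opprK; lia.
Qed.

Lemma pitmanK S S' : paths0 S -> recovers S -> is_pitman S S' ->
  is_pitman (flip S') (flip S).
Proof.
move=> pS rS [f Sf ->]; eexists; first exact: pitman_min.
by apply/funext => n; rewrite /flip oppr0; ring.
Qed.

(** Cancelling S in T^-1 T S = S shows that M and the future infimum of S' differ by a constant. If
    M_N is attained at p and the infimum of S' after N at - q, then S' (- q) <= S' p, which forces S
    (- q) >= M_N. *)
Lemma pitmanK_recovers S S' : is_pitman S S' -> is_pitman (flip S') (flip S) ->
  recovers S.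
Proof.
move=> [f Sf E] [g S'g E'] m n.
have gf k l : f k = f l -> g (- k) = g (- l).
  move: (congr1 (@^~ (- k)) E') (congr1 (@^~ (- l)) E').
  by rewrite /flip !opprK E; lia.
pose N := Num.max m n; have [fN [p pN Sp]] := Sf N.
have fp : f p = f N by have := is_max_le Sf pN; have := is_max_ge p Sf; lia.
have [_ [q qN]] := S'g (- N).
have := (S'g (- p)).1 (- p) (lexx _); rewrite (gf _ _ fp) /flip E opprK.
move=> lt eq; exists (- q); first by lia.
have := is_max_le Sf (_ : N <= - q); have := fN m; lia.
Qed.

Lemma is_pitman_paths0 S S' : paths0 S -> is_pitman S S' -> paths0 S'.
Proof.
move=> pS [f Sf ->]; split=> [/=|n /=].
   by have [-> _] := pS; rewrite subr0 subrr.
have [fn [m mn Em]] := Sf n; have [gn [k kn Ek]] := Sf (n - 1).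
have := pathsS (n - 1) pS; rewrite subrK.
have := gn m; have := fn n (lexx _); have := fn k; have := gn (n-1) (lexx _).
by have [e | ?] := eqVneq m n; [rewrite e in Em|]; lia.
Qed.

(** * Critical ends and their invariance *)

Definition limsup_is (S : int -> int) (L : int) :=
  (exists N : int, forall n : int, N <= n -> S n <= L) /\
  (forall N : int, exists2 n : int, N <= n & S n = L).

Definition oscillation (S : int -> int) (d : int) :=
  (forall m p : int, m <= p -> S m - S p <= d) /\
  exists m p : int, m <= p /\ S m - S p = d.

(** A finite limsup of integers is attained infinitely often and eventually not exceeded; applied to
    - S and - l this says liminf = l. The constant K is L - l. *)
Definition critical_end (S : int -> int) := exists L l : int,
  [/\ limsup_is S L, limsup_is (fun n => - S n) (- l) & oscillation S (L - l)].

Lemma oscillation_flip S d : oscillation S d -> oscillation (flip S) d.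
Proof.
move=> [Sd [m [p [mp E]]]]; split => [i j ij|].
  by have := Sd (- j) (- i); rewrite /flip; lia.
by exists (- p), (- m); rewrite /flip !opprK; lia.
Qed.

(** A drop of TS starting at i is at most M_i - S_i, itself a drop of S. A deepest drop of S ending
    at p becomes the drop of TS from p to a later time where S is back at M_p. *)
Lemma oscillation_pitman S S' d : paths0 S -> recovers S -> is_pitman S S' ->
  oscillation S d -> oscillation S' d.
Proof.
move=> pS rS [f Sf ->] [Sd [m [p [mp E]]]]; split => [i j ij /=|].
  have [fi [k ki Ek]] := Sf i.
  have := is_max_le Sf ij; have := is_max_ge j Sf; have := Sd k i ki; lia.
have [fp [k kp Ek]] := Sf p; have [q pq [Sq fq]] := is_max_record p pS rS Sf.
exists p, q; split => //=.
have := Sd k p kp; have := fp m mp; lia.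
Qed.

Lemma limsup_reflect S S' (L c : int) : limsup_is S L ->
  (exists N : int, forall n : int, N <= n -> S' n = c - S n) ->
  limsup_is (fun n => - S' n) (L - c).
Proof.
move=> [[N SL] SiL] [N' E]; split => [|K].
  exists (Num.max N N') => n nN; have := SL n; rewrite E; lia.
have [n nN Sn] := SiL (Num.max K N'); exists n; first by lia.
by rewrite E; lia.
Qed.

(** At a critical end of a reversible path, M and I are eventually constant, so T and T^-1 act there
    as S |-> c - S, which exchanges limsup and liminf. *)
Lemma critical_reflect S S' (L l c : int) :
  limsup_is S L -> limsup_is (fun n => - S n) (- l) ->
  (exists N : int, forall n : int, N <= n -> S' n = c - S n) ->
  limsup_is S' (c - l) /\ limsup_is (fun n => - S' n) (- (c - L)).
Proof.
move=> SL Sl E; split; last first.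
  by rewrite opprB; exact: (limsup_reflect SL E).
have [N' {}E] := E.
have -> : S' = fun n => - - S' n by apply/funext => n; rewrite opprK.
have := @limsup_reflect (fun n => - S n) (fun n => - S' n) (- l) (- c) Sl.
rewrite opprK addrC; apply; exists N' => n nN; rewrite E //; lia.
Qed.

Lemma limsup_recovers S (L : int) : limsup_is S L -> recovers S ->
  forall n, S n <= L.
Proof.
move=> [[N SL] _] rS n; have [q nq Sq] := rS n N.
exact: (le_trans Sq (SL _ nq)).
Qed.

Lemma is_max_eventually S f (L : int) : limsup_is S L -> recovers S ->
  is_max S f -> exists N : int, forall n : int, N <= n -> f n = L.
Proof.
move=> SL rS Sf; have Sle := limsup_recovers SL rS.
have [_ /(_ 0)[N _ SN]] := SL.
exists N => n Nn; have [fn [m mn Em]] := Sf n.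
by have := fn N Nn; have := Sle m; lia.
Qed.

Lemma is_min_eventually S f (l : int) : limsup_is (fun n => - S n) (- l) ->
  is_max (flip S) (flip f) -> exists N : int, forall n : int, N <= n -> f n = l.
Proof.
move=> [[N Sl] Sil] Sf; exists N => n Nn.
have := Sf (- n); rewrite /flip opprK => -[fn [m mn Em]].
have [q nq Sq] := Sil n; have := fn (- q); have := Sl (- m).
rewrite opprK; lia.
Qed.

Lemma critical_pitman S S' : reversible S -> is_pitman S S' ->
  critical_end S -> critical_end S'.
Proof.
move=> [pS _ _ rS _] SS' [L [l [SL Sl SD]]].
have D' := oscillation_pitman pS rS SS' SD.
have [f Sf E] := SS'.
have [N fN] := is_max_eventually SL rS Sf.
have [|? ?] := @critical_reflect S S' L l (2 * L - 2 * f 0) SL Sl.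
  by exists N => n nN; rewrite E fN //=; lia.
exists (2 * L - 2 * f 0 - l), (2 * L - 2 * f 0 - L); split => //.
by have -> : 2 * L - 2 * f 0 - l - (2 * L - 2 * f 0 - L) = L - l by lia.
Qed.

Lemma critical_pitman_inv S S' : reversible S -> is_pitman (flip S) (flip S') ->
  critical_end S -> critical_end S'.
Proof.
move=> [pS _ _ _ rS] SS' [L [l [SL Sl SD]]].
have D' : oscillation S' (L - l).
  rewrite -(flipK S'); apply: oscillation_flip.
  apply: oscillation_pitman SS' _ => //; first exact: flip_paths0.
  exact: oscillation_flip.
have [f Sf /(congr1 (@flip _)) E] := SS'; rewrite flipK in E.
rewrite -(flipK f) in Sf.
have [N fN] := is_min_eventually Sl Sf.
have [|? ?] := @critical_reflect S S' L l (2 * l + 2 * f 0) SL Sl.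
  exists N => n nN; rewrite E -(fN n nN) /flip !opprK /=; lia.
exists (2 * l + 2 * f 0 - l), (2 * l + 2 * f 0 - L); split => //.
by have -> : 2 * l + 2 * f 0 - l - (2 * l + 2 * f 0 - L) = L - l by lia.
Qed.

Lemma oscillation_bounded S d : oscillation S d -> bounded_past S.
Proof.
by move=> [Sd _]; exists (S 0 + d) => m m0; have := Sd m 0 m0; lia.
Qed.

Lemma critical_recovers S : critical_end S -> recovers S.
Proof.
move=> [L [l [[_ SiL] [_ Sil] [Sd _]]]] m n.
have [q nq Sq] := SiL n; exists q => //.
have [p mp Sp] := Sil m; have := Sd m p mp; lia.
Qed.

Lemma limsup_exists S (b c : int) : (forall n : int, 0 <= n -> S n <= b) ->
  (forall n : int, 0 <= n -> c <= S n) -> exists L, limsup_is S L.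
Proof.
move=> Sb Sc.
pose A x := forall N : int, exists2 n : int, N <= n & x <= S n.
have A0 : A c by move=> N; exists (Num.max 0 N); [lia|apply: Sc; lia].
have Ab x : A x -> x <= b.
  by move=> /(_ 0)[n /Sb]; lia.
have [L AL maxL] := int_max A0 Ab.
have [N SN] : exists N : int, forall n : int, N <= n -> S n <= L.
  have /existsNP[N nS] : ~ A (L + 1) by move=> /maxL; lia.
  exists N => n Nn; rewrite leNgt; apply/negP => Ln.
  by apply: nS; exists n => //; lia.
exists L; split; first by exists N.
move=> K; have [n nK Ln] := AL (Num.max N K).
exists n; first by lia.
by have := SN n; lia.
Qed.

(** * Paths bounded above: the forward orbit *)

Definition forward_orbit (U : nat -> int -> int) :=
  forall j, reversible (U j) /\ is_pitman (U j) (U j.+1).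

Lemma forward_orbitS U : forward_orbit U -> forward_orbit (U \o succn).
Proof. by move=> HU j; apply: HU. Qed.

(** Induction on a bound for L - S_m. With q a return time to M_p, TS drops by M_p - S_p > L - l
    from p to q. Its start is (L - M_p) + (L - l) - (M_p - S_p) < L - S_m below the new limsup, and
    reversibility of TS keeps this distance nonnegative. *)
Lemma orbit_drop U (L l m p : int) : forward_orbit U ->
  limsup_is (U 0%N) L -> limsup_is (fun n => - U 0%N n) (- l) -> m <= p ->
  U 0%N m - U 0%N p <= L - l.
Proof.
move=> fU SL Sl mp; rewrite leNgt; apply/negP => drop.
have [h Lh] : exists h : nat, L - U 0%N m <= h%:Z.
  have [[_ _ _ rS _] _] := fU 0%N.
  by have := limsup_recovers SL rS m; exists `|(L - U 0%N m)%R|%N; lia.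
elim: h U L l m p fU SL Sl mp drop Lh => [|h IH] U L l m p fU SL Sl mp drop Lh.
all: have [[pS _ _ rS _] [f Sf E]] := fU 0%N.
all: have [[_ _ _ rS' _] _] := fU 1%N.
all: have [N fN] := is_max_eventually SL rS Sf.
all: have Sp := limsup_recovers SL rS.
all: have [|S'L S'l] := @critical_reflect (U 0%N) (U 1%N) L l
    (2 * L - 2 * f 0) SL Sl;
  first by exists N => n nN; rewrite E fN //=; lia.
all: have := limsup_recovers S'L rS' p; rewrite E /=.
all: have [fp [k kp Sk]] := Sf p; have := fp m mp.
  by have := Sp k; lia.
move=> fm Lp; have [q pq [Sq fq]] := is_max_record p pS rS Sf.
apply: (IH (U \o succn) _ _ p q (forward_orbitS fU) S'L S'l pq) => /=;
  rewrite E /=; lia.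
Qed.

Lemma orbit_critical U (b : int) : forward_orbit U ->
  (forall n, U 0%N n <= b) -> critical_end (U 0%N).
Proof.
move=> fU Ub; have [[pS _ [c Sc] rS _] _] := fU 0%N.
have cS (n : int) : 0 <= n -> - c <= U 0%N n.
  by move=> n0; have := Sc (- n); rewrite /flip opprK; lia.
have [L SL] := limsup_exists (fun n _ => Ub n) cS.
have [|n n0|l Sl] := @limsup_exists (fun n => - U 0%N n) c (- b).
- by move=> n n0; have := cS n n0; lia.
- by have := Ub n; lia.
rewrite -(opprK l) in Sl; exists L, (- l); split => //.
split=> [m p mp|]; first exact: (orbit_drop fU SL Sl mp).
(* The bound is attained by a visit to L followed by a later visit to the liminf. *)
have [_ /(_ 0)[m _ Sm]] := SL; have [_ /(_ m)[p mp Sp]] := Sl.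
by exists m, p; split => //; lia.
Qed.

Lemma flip_reversible S : reversible S -> reversible (flip S).
Proof.
move=> [pS bS bfS rS rfS]; split; rewrite ?flipK //; exact: flip_paths0.
Qed.

(** * Paths unbounded above: the backward orbit *)

Definition unbounded (S : int -> int) :=
  forall c : int, exists n : int, c < S n.

Definition backward_orbit (U : nat -> int -> int) :=
  forall j, reversible (U j) /\ is_pitman (flip (U j)) (flip (U j.+1)).

Lemma max_unbounded S f (c : int) : is_max S f -> unbounded S ->
  exists N : int, forall n : int, N <= n -> c < f n.
Proof.
move=> Sf uS; have [N cN] := uS c; exists N => n Nn.
exact: lt_le_trans cN ((Sf n).1 N Nn).
Qed.

(** Mirror image of [pitman_min]: with I the future infimum of S, the running maximum of T^-1 S is I
    - 2 I_0. *)
Lemma pitman_inv_max S S' : reversible S -> is_pitman (flip S) (flip S') ->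
  exists2 g : int -> int, is_max (flip S) (flip g) &
    S' = (fun n => 2 * g n - S n - 2 * g 0) /\
    is_max S' (fun n => g n - 2 * g 0).
Proof.
move=> [pS _ _ rS rfS] [f Sf E].
have E' : S' = fun n => 2 * flip f n - S n - 2 * flip f 0.
  rewrite -(flipK S') E; apply/funext => n; rewrite /flip !opprK oppr0; ring.
exists (flip f); rewrite ?flipK //; split=> //.
have := pitman_min (flip_paths0 pS) rfS Sf; rewrite -E flipK.
congr is_max; apply/funext => n; rewrite /flip oppr0; ring.
Qed.

(** If T^-1 S were bounded above, so would be I. Since T^-1 S is bounded below on the positive
    times, S = 2 I - T^-1 S - 2 I_0 would be bounded above there, and it already is on the past. *)
Lemma pitman_inv_unbounded S S' : reversible S -> reversible S' ->
  is_pitman (flip S) (flip S') -> unbounded S -> unbounded S'.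
Proof.
move=> RS RS' /(pitman_inv_max RS)[g Sg [E Mg]] uS c.
apply: contrapT => /forallNP S'c.
have gc n : g n <= c + 2 * g 0.
  have [_ [m _ Em]] := Mg n; have := S'c m; lia.
have [_ [a Sa] [b S'b] _ _] := RS'; have [_ [a' Sa'] _ _ _] := RS.
have [n nS] := uS (Num.max a' (2 * c + 2 * g 0 + b)).
have n0 : 0 < n by rewrite ltNge; apply/negP => /Sa'; lia.
have := S'b (- n); have := gc n; rewrite /flip opprK E; lia.
Qed.

(* [b] absorbs the constants 2 I_0 accumulated by the iterates of T^-1. *)
Lemma orbit_gap (a : nat) (b : int) U f : backward_orbit U ->
  unbounded (U 0%N) -> is_max (U 0%N) f ->
  exists N : int, forall n : int, N <= n -> a%:Z * (f n - U 0%N n) < f n - b.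
Proof.
elim: a b U f => [|a IH] b U f HU uU Uf.
  by have [N fN] := max_unbounded b Uf uU; exists N => n /fN; lia.
have [[R0 T0] [R1 _]] := (HU 0%N, HU 1%N).
have uU1 := pitman_inv_unbounded R0 R1 T0 uU.
have [g Ug [E Mg]] := pitman_inv_max R0 T0.
have [|N HN] := IH (b - 2 * g 0) (U \o succn) _ _ uU1 Mg.
  by move=> j; apply: HU.
(* Once M_n exceeds M_N, the time m where M_n is attained lies beyond N. *)
have [N' HN'] := max_unbounded (f N) Uf uU.
exists N' => n N'n; have [_ [m mn Um]] := Uf n.
have Nm : N <= m.
  by rewrite leNgt; apply/negP => /ltW/(Uf N).1; have := HN' n N'n; lia.
(* At m the gap of T^-1 S is f n - g m, so the hypothesis reads a (f n - g m) < g m - b. Adding f n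
   - g m and using g m <= S_n gives the case a + 1. *)
have := HN m Nm; rewrite /= E.
have := Ug (- m); rewrite /flip opprK => -[gm _].
have := gm (- m) (lexx _); have := gm (- n); rewrite !opprK -Um; nia.
Qed.

(** * Sub-critical ends and their invariance *)

Section subcritical.
Variable R : realType.
Implicit Types (S : int -> int) (F : int -> R).

(** A bounded monotone F converges, and then so does s, which contradicts its unit steps. *)
Lemma asymptotic_dvg (s F : nat -> R) : nondecreasing_seq F ->
  (forall k, `|s k.+1 - s k| = 1) -> s k / F k @[k --> \oo] --> (1 : R) ->
  F k @[k --> \oo] --> +oo.
Proof.
move=> ndF s1 sF; apply/cvgryPge => A.
have [[n AF]|/forallNP nA] := pselect (exists n, A <= F n).
  by near=> k; apply: (le_trans AF); apply: ndF; near: k; exact: nbhs_infty_ge.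
exfalso; have cF : cvgn F.
  apply: nondecreasing_is_cvgn => //; exists A => _ [k _ <-].
  by have /negP := nA k; rewrite -ltNge => /ltW.
have sL : s k @[k --> \oo] --> limn F.
  rewrite -[limn F]mul1r; apply: cvg_trans (cvgM sF cF).
  (* As x / 0 = 0, a nonzero quotient has a nonzero denominator, so s = (s / F) F eventually. *)
  apply: near_eq_cvg; move/cvgr_neq0: (sF) => /(_ (oner_neq0 R)).
  by apply: filterS => k sk; rewrite /= mulfVK//;
    apply: contraNneq sk => ->; rewrite invr0 mulr0.
have sL' : s k.+1 @[k --> \oo] --> limn F.
  by move: sL; rewrite -cvg_shiftS.
have : s k.+1 - s k @[k --> \oo] --> limn F - limn F by exact: cvgB.
move/cvgrPdist_lt => /(_ 1 ltr01)/filter_ex[k /=].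
by rewrite subrr sub0r normrN s1 ltxx.
Unshelve. all: by end_near. Qed.

(** The quotient condition with the denominator cleared; it forces F >= 0 from some time on. *)
Definition approximates S F := forall e : R, 0 < e ->
  exists N : int, forall n : int, N <= n -> `|(S n)%:~R - F n| <= e * F n.

Definition sub_critical_end S :=
  exists2 F : int -> R, strictly_increasing F & approximates S F.

Lemma near_int (P : int -> Prop) :
  (\forall k \near \oo, P k%:Z) <->
  exists N : int, forall n : int, N <= n -> P n.
Proof.
split=> [[N _ HN]|[N HN]].
  exists N%:Z => n Nn; have -> : n = `|n|%N by lia.
  by apply: HN => /=; lia.
by exists `|N|%N => // k /= Nk; apply: HN; lia.
Qed.

Lemma int_step_nat S (k : nat) : paths0 S ->
  `|(S k.+1%:Z)%:~R - (S k%:Z)%:~R| = 1 :> R.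
Proof.
move=> [_ /(_ k.+1%:Z)]; rewrite (_ : k.+1%:Z - 1 = k%:Z); last lia.
by move=> E; rewrite -intrB -intr_norm E.
Qed.

Lemma strictly_increasing_nd F : strictly_increasing F ->
  {homo F : m n / m <= n}.
Proof. by move=> F_ m n; rewrite le_eqVlt => /predU1P[->//|/F_/ltW]. Qed.

Lemma asymptotic_plus_dvg S F : strictly_increasing F -> paths0 S ->
  asymptotic_to plus S F -> F (toward plus k) @[k --> \oo] --> +oo.
Proof.
move=> /strictly_increasing_nd F_ pS.
apply: asymptotic_dvg => [m n mn|k]; first exact: F_.
exact: int_step_nat.
Qed.

Lemma asymptoticP S F : strictly_increasing F -> paths0 S ->
  asymptotic_to plus S F <-> approximates S F.
Proof.
move=> F_ pS; split => [SF e e0|SF].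
  have /cvgryPgt/(_ 0) F0 := asymptotic_plus_dvg F_ pS SF.
  move/cvgrPdist_le: SF => /(_ e e0) SF; apply/near_int.
  apply: filterS2 F0 SF => k /= F0 SF.
  have -> : (S k)%:~R - F k = - ((1 - (S k)%:~R / F k) * F k).
    by rewrite mulrBl mul1r mulfVK ?gt_eqF// opprB.
  by rewrite normrN normrM (gtr0_norm F0) ler_pM2r.
apply/cvgrPdist_le => e e0; have [N SN] := SF e e0; have [N1 SN1] := SF 1 ltr01.
apply/(near_int (fun n => `|1 - (S n)%:~R / F n| <= e)).
(* F is nonnegative at N1, hence strictly positive from N1 + 1 on. *)
exists (Num.max N (N1 + 1)) => n Nn.
have F0 : 0 < F n.
  apply: (@le_lt_trans _ _ (F N1)); last by apply: F_; lia.
  by have := le_trans (normr_ge0 _) (SN1 N1 (lexx _)); rewrite mul1r.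
have -> : 1 - (S n)%:~R / F n = - (((S n)%:~R - F n) / F n).
  by rewrite mulrBl divff ?gt_eqF// opprB.
rewrite normrN normrM normfV (gtr0_norm F0) ler_pdivrMr//; apply: SN; lia.
Qed.

Lemma approximates_dvg S F (A : R) : strictly_increasing F -> paths0 S ->
  approximates S F -> exists N : int, forall n : int, N <= n -> A <= F n.
Proof.
move=> F_ pS /(asymptoticP F_ pS)/(asymptotic_plus_dvg F_ pS)/cvgryPge/(_ A).
by move/(near_int (fun n => A <= F n)).
Qed.

Lemma sub_critical_dvg S (c : int) : paths0 S -> sub_critical_end S ->
  exists N : int, forall n : int, N <= n -> c < S n.
Proof.
move=> pS [F F_ SF]; have [|N SN] := SF (1 / 2); first lra.
(* With error 1 / 2 one has S >= F / 2, so F >= 2 c + 1 is enough. *)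
have [N' FN] := approximates_dvg (2 * c%:~R + 1) F_ pS SF.
exists (Num.max N N') => n nN; rewrite -(ltr_int R).
have [x1 x2] : N <= n /\ N' <= n by lia.
have := SN n x1; have := FN n x2; rewrite ler_norml => ? /andP[? ?]; lra.
Qed.

Lemma sub_critical_bounded S : paths0 S -> sub_critical_end S ->
  bounded_past (flip S).
Proof.
move=> pS /(sub_critical_dvg 0 pS)[N SN].
have [b Sb] : exists b : int, forall n : int,
    0 <= n -> n <= Num.max 0 N -> - S n <= b.
  have N0 : 0 <= Num.max 0 N by lia.
  move: (Num.max 0 N) N0.
  apply: int_ind_up; first by exists (- S 0) => n n0 n0';
    rewrite (_ : n = 0) //; lia.
  move=> m m0 [b Sb]; exists (Num.max b (- S (m + 1))) => n n0 nm.
  have [->|?] := eqVneq n (m + 1); first lia.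
  by have := Sb n; lia.
exists (Num.max 0 b) => n n0; rewrite /flip.
by have := Sb (- n); have := SN (- n); lia.
Qed.

Lemma sub_critical_recovers S : paths0 S -> sub_critical_end S -> recovers S.
Proof.
move=> pS sS m n; have [N SN] := sub_critical_dvg (S m) pS sS.
by exists (Num.max n N); [lia|have := SN (Num.max n N); lia].
Qed.

(** T and T^-1 both have the shape 2 f - S - c. The error e splits into quarters: two for f, one for
    S and one for c, which the divergence of F absorbs. *)
Lemma approximates_reflect S S' f F (c : int) : strictly_increasing F ->
  paths0 S -> approximates S F -> approximates f F ->
  S' = (fun n => 2 * f n - S n - c) -> approximates S' F.
Proof.
move=> F_ pS SF fF -> e e0.
have [|N SN] := SF (e / 4); first lra.
have [|N' fN] := fF (e / 4); first lra.
have [K FK] := approximates_dvg (`|c|%:~R / (e / 4)) F_ pS SF.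
exists (Num.max K (Num.max N N')) => n Hn.
have := SN n; have := fN n; have := FK n.
rewrite ler_pdivrMr; last lra.
rewrite !intrB intrM intr_norm.
have [x1 [x2 x3]] : K <= n /\ N <= n /\ N' <= n by lia.
move=> /(_ x1) H1 /(_ x3) H2 /(_ x2) H3.
move: H1 H2 H3; rewrite !ler_norml => H1 /andP[H2 H2'] /andP[H3 H3'].
have := ler_norm (c%:~R : R); have := ler_norm (- c%:~R : R); rewrite normrN.
by move=> ? ?; apply/andP; split; lra.
Qed.

(** The lower bound is S <= M. For the upper one, M_n is attained either before N, where the fixed
    value M_N is below F n for large n, or at m > N, where S m <= (1 + e) F m <= (1 + e) F n. *)
Lemma approximates_max S f F : strictly_increasing F -> paths0 S ->
  is_max S f -> approximates S F -> approximates f F.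
Proof.
move=> F_ pS Sf SF e e0; have [N SN] := SF e e0.
have [K FK] := approximates_dvg (Num.max 0 (f N)%:~R) F_ pS SF.
exists (Num.max K N) => n Hn.
have [x1 x2] : K <= n /\ N <= n by lia.
have := FK n x1; rewrite ge_max => /andP[F0 fNF].
have Sfn : (S n)%:~R <= (f n)%:~R :> R by rewrite ler_int (is_max_ge n Sf).
have := SN n x2; rewrite !ler_norml => /andP[H1 H2].
have eF : 0 <= e * F n by rewrite mulr_ge0 // ltW.
apply/andP; split; first lra.
have [_ [m mn <-]] := Sf n; have [mN|Nm] := leP m N.
  have : (S m)%:~R <= (f N)%:~R :> R by rewrite ler_int (Sf N).1.
  lra.
have := SN m (ltW Nm); rewrite ler_norml => /andP[_].
have Fmn := strictly_increasing_nd F_ mn.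
have : e * F m <= e * F n by rewrite ler_pM2l.
lra.
Qed.

Lemma approximates_min S f F : strictly_increasing F -> paths0 S ->
  is_max (flip S) (flip f) -> approximates S F -> approximates f F.
Proof.
move=> F_ pS Sf SF e e0.
(* The infimum is attained at a later time - m, where S >= (1 - d) F (- m). The cap at 1 keeps 1 - d
   nonnegative, so this is at least (1 - d) F n. *)
pose d := Num.min e 1.
have [d0 de d1] : [/\ 0 < d, d <= e & d <= 1].
  by rewrite /d lt_min e0 ltr01 !ge_min !lexx orbT.
have [N SN] := SF d d0; have [K FK] := approximates_dvg 0 F_ pS SF.
exists (Num.max K N) => n Hn.
have [x1 x2] : K <= n /\ N <= n by lia.
have F0 := FK n x1.
have dF : d * F n <= e * F n by rewrite ler_wpM2r.
have := Sf (- n); rewrite /flip opprK => -[fn [m mn Em]].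
have := fn (- n) (lexx _); rewrite opprK lerN2 => Sfn.
have {}Sfn : (f n)%:~R <= (S n)%:~R :> R by rewrite ler_int.
have := SN n x2; rewrite !ler_norml => /andP[H1 H2].
apply/andP; split; last lra.
have -> : f n = S (- m) by lia.
have := SN (- m); rewrite ler_norml => /(_ _)/andP[|H3 _]; first lia.
have Fmn : F n <= F (- m) by apply: strictly_increasing_nd => //; lia.
have : (1 - d) * F n <= (1 - d) * F (- m) by rewrite ler_wpM2l // subr_ge0.
lra.
Qed.

Lemma sub_critical_pitman S S' : paths0 S -> is_pitman S S' ->
  sub_critical_end S -> sub_critical_end S'.
Proof.
move=> pS [f Sf E] [F F_ SF]; exists F => //.
exact: approximates_reflect pS SF (approximates_max F_ pS Sf SF) E.
Qed.

Lemma sub_critical_pitman_inv S S' : reversible S ->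
  is_pitman (flip S) (flip S') -> sub_critical_end S -> sub_critical_end S'.
Proof.
move=> RS /(pitman_inv_max RS)[g Sg [E _]] [F F_ SF]; exists F => //.
have [pS _ _ _ _] := RS.
exact: approximates_reflect pS SF (approximates_min F_ pS Sg SF) E.
Qed.

Lemma orbit_sub_critical U : backward_orbit U -> unbounded (U 0%N) ->
  sub_critical_end (U 0%N).
Proof.
move=> HU uU; have [[_ bU _ _ _] _] := HU 0%N.
have [f Uf] := is_max_exists bU.
(* A strictly increasing perturbation bounded by 1: M alone is only nondecreasing. *)
pose t (n : int) : R := n%:~R / (1 + `|n|)%:~R.
have t1 n : `|t n| <= 1.
  rewrite /t normrM normfV -!intr_norm ler_pdivrMr ?mul1r ?ler_int ?ltr0z; lia.
exists (fun n => (f n)%:~R + t n).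
  move=> m n mn; apply: ler_ltD; first by rewrite ler_int (is_max_le Uf) // ltW.
  rewrite /t ltr_pdivrMr ?ltr0z; last lia.
  rewrite mulrAC ltr_pdivlMr ?ltr0z; last lia.
  by rewrite -!intrM ltr_int; nia.
move=> e e0.
have [a ae] : exists a : nat, 1 <= a%:R * e.
  exists (Num.trunc e^-1).+1; rewrite -ler_pdivrMr // div1r.
  by apply/ltW; rewrite truncnS_gt.
(* The offset a + 1 absorbs the perturbation: a (M - S) < M - a - 1 and |t| <= 1 give a (M + t - S)
   <= M + t. It also gives M + t >= a, so e (M + t) >= 1 bounds the error on the other side. *)
have [N HN] := orbit_gap a (a%:Z + 1) HU uU Uf.
exists N => n nN; have := HN n nN; have := t1 n.
rewrite ler_norml => /andP[t2 t3].
rewrite -(ltr_int R) !intrM !intrB intrD -pmulrn => H.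
have := is_max_ge n Uf; rewrite -(ler_int R) => H1.
rewrite ler_norml.
set u := (U 0%N n)%:~R in H H1 *; set x := (f n)%:~R in H H1 *.
set b := a%:R in ae H.
have H2 : b * (x + t n - u) <= x + t n by nra.
have : (x + t n - u) <= e * (x + t n).
  have : e * (b * (x + t n - u)) <= e * (x + t n) by rewrite ler_pM2l.
  nra.
nra.
Qed.

End subcritical.

(** * From suprema in the extended reals to integer-valued extrema *)

Section link.
Variable R : realType.
Implicit Types S : int -> int.

Lemma is_max_M S f n : is_max S f -> M_ R S n = ((f n)%:~R)%:E.
Proof.
move=> Sf; have [fn [m mn Em]] := Sf n; apply/eqP.
rewrite eq_le; apply/andP; split.
  by apply: ge_ereal_sup => _ [k kn <-]; rewrite lee_fin ler_int; exact: fn.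
by rewrite -Em; apply: ereal_sup_ubound; exists m.
Qed.

Lemma is_max_floorM S f : is_max S f -> Defs.floorM R S = f.
Proof.
by move=> Sf; apply/funext => n;
  rewrite /Defs.floorM (is_max_M n Sf) /= intrKfloor.
Qed.

Lemma M0_lty S : (M_ R S 0 < +oo)%E <-> bounded_past S.
Proof.
split=> [M0|/is_max_exists[f Sf]]; last by rewrite (is_max_M 0 Sf) ltry.
have ub m : m <= 0 -> (embed R S m <= M_ R S 0)%E.
  by move=> m0; apply: ereal_sup_ubound; exists m.
have Mfin : M_ R S 0 \is a fin_num.
  by rewrite fin_numE gt_eqF ?lt_eqF//;
    apply: lt_le_trans (ub 0 _); rewrite ?ltNyr.
exists (Defs.floorM R S 0) => m /ub.
by rewrite -(Defs.floor_M Mfin) lee_fin ler_int.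
Qed.

Lemma pitmanP S S' : pitman R S = Some S' <-> is_pitman S S'.
Proof.
rewrite /pitman; split=> [|[f Sf ->]].
  case: ifPn => // /M0_lty/is_max_exists[f Sf] [<-].
  by rewrite (is_max_floorM Sf); exists f.
rewrite (is_max_floorM Sf) ifT //; apply/M0_lty; exact: is_max_bounded Sf.
Qed.

Lemma isSome_pitman S : isSome (pitman R S) <-> bounded_past S.
Proof. by rewrite -M0_lty /pitman; case: ifP. Qed.

Lemma embed_flip S n : embed R (flip S) n = (- embed R S (- n))%E.
Proof. by rewrite /embed /flip intrN. Qed.

Lemma M_flip S n : M_ R (flip S) n = (- I_ R S (- n))%E.
Proof.
rewrite /I_ /M_ /ereal_inf oppeK; congr ereal_sup; apply/seteqP; split => x /=.
  move=> [m mn <-]; exists (embed R S (- m)); last by rewrite embed_flip.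
  by exists (- m); rewrite ?lerN2.
move=> [_ [m mn <-] <-]; exists (- m); first by rewrite lerNl.
by rewrite embed_flip opprK.
Qed.

Lemma I0_gtNy S : (-oo < I_ R S 0)%E <-> bounded_past (flip S).
Proof. by rewrite -M0_lty M_flip oppr0 -lteNl. Qed.

Lemma pitman_inv_flip S :
  pitman_inv R S = omap (@flip _) (pitman R (flip S)).
Proof.
rewrite /pitman_inv /pitman.
have [I0|nI] := boolP (-oo < I_ R S 0)%E; last first.
  rewrite ifF //; apply/negP => /M0_lty/I0_gtNy; exact/negP.
have bS := (I0_gtNy S).1 I0; rewrite ((M0_lty _).2 bS).
have [f Sf] := is_max_exists bS; rewrite (is_max_floorM Sf) /=; congr Some.
(* Floor does not commute with negation in general; it does here because the value is an integer. *)
have -> : floorI R S = flip f.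
  apply/funext => n.
  rewrite /floorI -(opprK n) -[I_ _ _ _]oppeK -M_flip (is_max_M _ Sf) /=.
  by rewrite -intrN intrKfloor /flip opprK.
apply/funext => n; rewrite /flip !opprK oppr0; ring.
Qed.

Lemma pitman_invP S S' :
  pitman_inv R S = Some S' <-> is_pitman (flip S) (flip S').
Proof.
rewrite pitman_inv_flip -pitmanP; case: (pitman R (flip S)) => [U|] //=.
split=> [[<-]|[->]]; by rewrite flipK.
Qed.

Lemma isSome_pitman_inv S : isSome (pitman_inv R S) <-> bounded_past (flip S).
Proof. by rewrite pitman_inv_flip -isSome_pitman; case: pitman. Qed.

(** [pitmanK_recovers] and [pitmanK] give the two directions, each applied to S and to its
    reflection. *)
Lemma SrevP S : Srev R S <-> reversible S.
Proof.
split=> [[pS /isSome_pitman bS /isSome_pitman_inv bfS ]|[pS bS bfS rS rfS]].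
  have [S' SS'] := is_pitman_exists bS; have [S'' SS''] := is_pitman_exists bfS.
  rewrite -(flipK S'') in SS''.
  have := SS'; rewrite -pitmanP => -> /= /pitman_invP H.
  have := SS''; rewrite -pitman_invP => -> /= /pitmanP H'.
  split=> //; first exact: pitmanK_recovers SS' H.
  by apply: pitmanK_recovers SS'' _; rewrite !flipK.
split=> //; [exact/isSome_pitman|exact/isSome_pitman_inv| |].
  have [S' SS'] := is_pitman_exists bS.
  have := SS'; rewrite -pitmanP => -> /=; apply/pitman_invP; exact: pitmanK.
have [S' SS'] := is_pitman_exists bfS; rewrite -(flipK S') in SS'.
have := SS'; rewrite -pitman_invP => -> /=; apply/pitmanP.
by have := pitmanK (flip_paths0 pS) rfS SS'; rewrite !flipK.
Qed.

(** * Membership in S^inv and regular ends *)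

Lemma Sinv_forward S : Sinv R S ->
  exists2 U, forward_orbit U & U 0%N = S.
Proof.
move=> [_ HS].
have H (j : nat) : exists S',
    iter j (obind (pitman R)) (Some S) = Some S' /\ reversible S'.
  by have [S' E /SrevP] := HS j; exists S'.
have [U HU] := choice H; exists U; last by have [[->] _] := HU 0%N.
move=> j; have [E rU] := HU j; have [] := HU j.+1; rewrite iterS E /= => E' _.
by split=> //; apply/pitmanP.
Qed.

Lemma Sinv_backward S : Sinv R S ->
  exists2 U, backward_orbit U & U 0%N = S.
Proof.
move=> [_ HS].
have H (j : nat) : exists S',
    iter j (obind (pitman_inv R)) (Some S) = Some S' /\ reversible S'.
  (* [Negz j] encodes j + 1 iterates of T^-1, so the zeroth iterate comes from k = 0. *)
  case: j => [|j].
    by have [S' E /SrevP] := HS 0; exists S'.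
  by have [S' E /SrevP] := HS (Negz j); exists S'.
have [U HU] := choice H; exists U; last by have [[->] _] := HU 0%N.
move=> j; have [E rU] := HU j; have [] := HU j.+1; rewrite iterS E /= => E' _.
by split=> //; apply/pitman_invP.
Qed.

Definition regular_end S := sub_critical_end R S \/ critical_end S.

(** A path unbounded above is sub-critical by its backward orbit; one bounded above is critical by
    its forward orbit. *)
Lemma Sinv_regular_end S : Sinv R S -> regular_end S.
Proof.
move=> HS; have [uS|nu] := pselect (unbounded S).
  left; have [U HU E] := Sinv_backward HS; rewrite -E in uS *.
  exact: orbit_sub_critical.
right; have /existsNP[b /forallNP Sb] := nu.
have [U HU E] := Sinv_forward HS; rewrite -E in Sb *.
by apply: (@orbit_critical U b) => // n; have := Sb n; lia.
Qed.

Lemma pitman_iter_flip S (k : int) :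
  pitman_iter R k (flip S) = omap (@flip _) (pitman_iter R (- k) S).
Proof.
have H1 (j : nat) : iter j (obind (pitman R)) (Some (flip S)) =
    omap (@flip _) (iter j (obind (pitman_inv R)) (Some S)).
  elim: j => //= j ->; case: (iter _ _ _) => //= U.
  by rewrite pitman_inv_flip; case: pitman => //= V; rewrite flipK.
have H2 (j : nat) : iter j (obind (pitman_inv R)) (Some (flip S)) =
    omap (@flip _) (iter j (obind (pitman R)) (Some S)).
  elim: j => //= j ->; case: (iter _ _ _) => //= U.
  by rewrite pitman_inv_flip flipK.
by case: k => [[|j]|j] //; [exact: (H1 j.+1)|exact: (H2 j.+1)].
Qed.

Lemma Sinv_flip S : Sinv R S -> Sinv R (flip S).
Proof.
move=> [pS HS]; split=> [|k]; first exact: flip_paths0.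
have [S' E rS'] := HS (- k); rewrite pitman_iter_flip E; exists (flip S') => //.
by apply/SrevP; apply: flip_reversible; apply/SrevP.
Qed.

Lemma regular_end_pitman S S' : reversible S -> is_pitman S S' ->
  regular_end S -> regular_end S'.
Proof.
move=> RS SS' [sS|cS]; [left|right]; last exact: critical_pitman SS' cS.
by have [pS _ _ _ _] := RS; exact: sub_critical_pitman SS' sS.
Qed.

Lemma regular_end_pitman_inv S S' : reversible S ->
  is_pitman (flip S) (flip S') -> regular_end S -> regular_end S'.
Proof.
move=> RS SS' [sS|cS]; [left|right]; last exact: critical_pitman_inv SS' cS.
exact: sub_critical_pitman_inv SS' sS.
Qed.

Definition regular S := [/\ paths0 S, regular_end S & regular_end (flip S)].

Lemma regular_flip S : regular S -> regular (flip S).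
Proof. by move=> [pS S1 S2]; split; rewrite ?flipK //; exact: flip_paths0. Qed.

Lemma regular_end_bounded S : paths0 S -> regular_end S ->
  bounded_past (flip S).
Proof.
move=> pS [/sub_critical_bounded|]; first exact.
by move=> [L [l [_ _ /oscillation_flip/oscillation_bounded]]].
Qed.

Lemma regular_end_recovers S : paths0 S -> regular_end S -> recovers S.
Proof.
by move=> pS [/sub_critical_recovers|/critical_recovers//]; exact.
Qed.

Lemma regular_reversible S : regular S -> reversible S.
Proof.
move=> [pS S1 S2]; have pfS := flip_paths0 pS; split=> //.
- by rewrite -(flipK S); exact: regular_end_bounded.
- exact: regular_end_bounded.
- exact: regular_end_recovers.
- exact: regular_end_recovers.
Qed.

Lemma regular_pitman S S' : is_pitman S S' -> regular S -> regular S'.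
Proof.
move=> SS' SR; have RS := regular_reversible SR; have [pS S1 S2] := SR; split.
- exact: is_pitman_paths0 SS'.
- exact: regular_end_pitman S1.
(* Seen from -oo, T is T^-1 acting on the reflected path. *)
apply: regular_end_pitman_inv S2; first exact: flip_reversible.
by rewrite !flipK.
Qed.

Lemma regular_Sinv S : regular S -> Sinv R S.
Proof.
move=> SR; split=> [|k]; first by have [] := SR.
have H S1 (j : nat) : regular S1 ->
    exists2 S', iter j (obind (pitman R)) (Some S1) = Some S' & regular S'.
  move=> S1R; elim: j => [|j [S' E S'R]]; first by exists S1.
  have [_ bS' _ _ _] := regular_reversible S'R.
  have [S'' SS''] := is_pitman_exists bS'; exists S''.
    by rewrite iterS E /=; apply/pitmanP.
  exact: regular_pitman SS'' S'R.
case: k => j.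
  have [S' E /regular_reversible S'R] := H S j SR; exists S' => //; exact/SrevP.
have [S' E S'R] := H _ j.+1 (regular_flip SR).
exists (flip S').
  rewrite -[S in pitman_iter _ _ S]flipK pitman_iter_flip.
  by rewrite /= in E *; rewrite E.
by apply/SrevP/regular_reversible; exact: regular_flip.
Qed.

Lemma SinvP S : Sinv R S <-> regular S.
Proof.
split; last exact: regular_Sinv.
move=> HS; split; [by case: HS|exact: Sinv_regular_end|].
by apply: Sinv_regular_end; exact: Sinv_flip.
Qed.

End link.

(** * Limsup and liminf of integer sequences, indexed by naturals to serve both ends *)

Definition limsup_seq (u : nat -> int) (L : int) :=
  (exists N, forall k, (N <= k)%N -> u k <= L) /\
  (forall N, exists2 k, (N <= k)%N & u k = L).

Lemma limsup_seqP S (L : int) :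
  limsup_is S L <-> limsup_seq (fun k => S k%:Z) L.
Proof.
split=> [[[N SN] SL]|[[N SN] SL]]; split.
- by exists `|N|%N => k Nk; apply: SN; lia.
- by move=> K; have [n Kn Sn] := SL K%:Z; exists `|n|%N;
    [lia|rewrite gez0_abs//; lia].
- exists N%:Z => n Nn; have -> : n = `|n|%N by lia.
  by apply: SN; lia.
- by move=> K; have [n Kn Sn] := SL `|K|%N; exists n%:Z => //; lia.
Qed.

(** Consecutive values differ while both eventually lie in [l, L]; this makes the K of a critical
    end positive. *)
Lemma limsup_seq_lt (u : nat -> int) (L l : int) : (forall k, u k.+1 != u k) ->
  limsup_seq u L -> limsup_seq (fun k => - u k) (- l) -> l < L.
Proof.
move=> u1 [[N uN] _] [[K uK] _]; have := u1 (maxn N K).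
have x1 := leq_maxl N K; have x2 := leq_maxr N K.
have := uN _ x1; have := uN _ (leqW x1).
have := uK _ x2; have := uK _ (leqW x2).
by move: (u (maxn N K)) (u (maxn N K).+1) => a b; lia.
Qed.

Section extended.
Variable R : realType.
Implicit Types (S : int -> int) (s : sign).

Lemma limn_esup_le (v : nat -> \bar R) (x : \bar R) N :
  (forall k, (N <= k)%N -> (v k <= x)%E) -> (limn_esup v <= x)%E.
Proof.
move=> vx; apply: (@le_trans _ _ (ereal_sup (v @` [set k | (N <= k)%N]))).
  apply: ereal_inf_lbound; exists [set k | (N <= k)%N] => //.
  exact: nbhs_infty_ge.
by apply: ge_ereal_sup => _ [k Nk <-]; exact: vx.
Qed.

Lemma limn_esup_ge (v : nat -> \bar R) (x : \bar R) :
  (forall N, exists2 k, (N <= k)%N & (x <= v k)%E) -> (x <= limn_esup v)%E.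
Proof.
move=> xv; apply: le_ereal_inf_tmp => _ [V [N _ NV] <-].
have [k Nk xk] := xv N; apply: (le_trans xk); apply: ereal_sup_ubound.
by exists k => //; exact: NV.
Qed.

Lemma limn_esup_limsup_seq (u : nat -> int) L : limsup_seq u L ->
  limn_esup (fun k => (u k)%:~R%:E : \bar R) = L%:~R%:E.
Proof.
move=> [[N uN] uL]; apply/eqP; rewrite eq_le; apply/andP; split.
  by apply: (@limn_esup_le _ _ N) => k /uN; rewrite lee_fin ler_int.
by apply: limn_esup_ge => K; have [k Kk <-] := uL K; exists k.
Qed.

(** With limsup r, infinitely many values above floor r would give a limsup of at least floor r + 1
    > r; if floor r occurred only finitely often, the limsup would be at most floor r - 1 < r. *)
Lemma limsup_seq_exists (u : nat -> int) :
  limn_esup (fun k => (u k)%:~R%:E : \bar R) \is a fin_num ->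
  exists L, limsup_seq u L.
Proof.
case E : limn_esup => [r| |] // _; exists (Num.floor r).
have uN : exists N, forall k, (N <= k)%N -> u k <= Num.floor r.
  apply: contrapT => /forallNP H.
  have : ((Num.floor r + 1)%:~R%:E <=
      limn_esup (fun k => (u k)%:~R%:E : \bar R))%E.
    apply: limn_esup_ge => N; have /existsNP[k /not_implyP[Nk uk]] := H N.
    by exists k => //; rewrite lee_fin ler_int; lia.
  by rewrite E lee_fin leNgt floorD1_gt.
split=> // K; have [N HN] := uN.
apply: contrapT => H.
have : (limn_esup (fun k => (u k)%:~R%:E : \bar R) <=
    (Num.floor r - 1)%:~R%:E)%E.
  apply: (@limn_esup_le _ _ (maxn N K)) => k; rewrite geq_max => /andP[Nk Kk].
  rewrite lee_fin ler_int; have := HN k Nk.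
  have : u k <> Num.floor r by move=> e; apply: H; exists k.
  lia.
have := floor_le r; rewrite E lee_fin intrB; lra.
Qed.

Lemma liminfE s S : liminf R s S = (- limsup R s (fun n => - S n)%R)%E.
Proof.
by rewrite /liminf /limn_einf; congr (- limn_esup _)%E;
  apply/funext => k; rewrite /= /embed intrN.
Qed.

Lemma limsup_limsup_seq s S L : limsup_seq (fun k => S (toward s k)) L ->
  limsup R s S = L%:~R%:E.
Proof. exact: limn_esup_limsup_seq. Qed.

Lemma liminf_limsup_seq s S l : limsup_seq (fun k => - S (toward s k)) (- l) ->
  liminf R s S = l%:~R%:E.
Proof.
move=> Sl; rewrite liminfE (@limsup_limsup_seq s (fun n => - S n) _ Sl).
by rewrite intrN EFinN oppeK.
Qed.

Lemma limsup_fin_num s S : limsup R s S \is a fin_num ->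
  exists L, limsup_seq (fun k => S (toward s k)) L.
Proof. exact: limsup_seq_exists. Qed.

Lemma liminf_fin_num s S : liminf R s S \is a fin_num ->
  exists l, limsup_seq (fun k => - S (toward s k)) (- l).
Proof.
rewrite liminfE fin_numN => /limsup_fin_num[L SL]; exists (- L).
by rewrite opprK.
Qed.

(** If the path never regains S m after n, then by integrality limsup <= S m - 1, which is below the
    supremum. *)
Lemma limsup_recoversP S :
  limsup R plus S = ereal_sup (range (embed R S)) <-> recovers S.
Proof.
split=> [E m n|rS].
  apply: contrapT => H.
  have : (limsup R plus S <= (S m - 1)%:~R%:E)%E.
    apply: (@limn_esup_le _ _ `|n|%N) => k nk; rewrite lee_fin ler_int leNgt.
    by apply/negP => /= Sk; apply: H; exists k%:Z; rewrite /=; lia.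
  rewrite E => H1.
  have : (embed R S m <= ereal_sup (range (embed R S)))%E.
    by apply: ereal_sup_ubound; exists m.
  by move=> /le_trans/(_ H1); rewrite lee_fin ler_int; lia.
apply/eqP; rewrite eq_le; apply/andP; split.
  by apply: (@limn_esup_le _ _ 0) => k _;
    apply: ereal_sup_ubound; exists (toward plus k).
apply: ge_ereal_sup => _ [m _ <-]; apply: limn_esup_ge => N.
have [q Nq mq] := rS m N%:Z; exists `|q|%N; first lia.
by rewrite lee_fin ler_int /= gez0_abs //; lia.
Qed.

Lemma limsup_flip S : limsup R plus (flip S) = (- liminf R minus S)%E.
Proof. by rewrite liminfE oppeK. Qed.

Lemma sup_embed_flip S :
  ereal_sup (range (embed R (flip S))) = (- ereal_inf (range (embed R S)))%E.
Proof.
rewrite /ereal_inf oppeK; congr ereal_sup; apply/seteqP; split => x /=.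
  move=> [m _ <-]; exists (embed R S (- m)); last by rewrite embed_flip.
  by exists (- m).
by move=> [_ [m _ <-] <-]; exists (- m); rewrite ?embed_flip ?opprK.
Qed.

Lemma liminf_recoversP S :
  liminf R minus S = ereal_inf (range (embed R S)) <-> recovers (flip S).
Proof.
rewrite -limsup_recoversP limsup_flip sup_embed_flip.
by split=> [->//|/oppe_inj].
Qed.

(** M is nondecreasing, so it converges to its supremum, which is that of S. *)
Lemma M_cvg S :
  (M_ R S \o toward plus) k @[k --> \oo] --> ereal_sup (range (embed R S)).
Proof.
have -> : ereal_sup (range (embed R S)) =
    ereal_sup (range (M_ R S \o toward plus)).
  apply/eqP; rewrite eq_le; apply/andP; split; apply: ge_ereal_sup.
    move=> _ [m _ <-]; apply: (@le_trans _ _ (M_ R S `|m|%N)).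
      by apply: ereal_sup_ubound; exists m => //=; lia.
    by apply: ereal_sup_ubound; exists `|m|%N.
  move=> _ [k _ <-]; apply: ge_ereal_sup => _ [m _ <-].
  by apply: ereal_sup_ubound; exists m.
apply: ereal_nondecreasing_cvgn => m n mn; apply: le_ereal_sup => _ [k km <-].
by exists k => //=; move: km => /=; lia.
Qed.

Lemma I_cvg S :
  (I_ R S \o toward minus) k @[k --> \oo] --> ereal_inf (range (embed R S)).
Proof.
rewrite -[ereal_inf _]oppeK -sup_embed_flip.
have -> : I_ R S \o toward minus =
    (fun k => - (M_ R (flip S) \o toward plus) k)%E.
  by apply/funext => k; rewrite /= M_flip oppeK.
by apply: cvgeN; exact: M_cvg.
Qed.

Lemma oscillation_le S (d : int) :
  (forall m p : int, m <= p -> S m - S p <= d) ->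
  (ereal_sup (range (fun n => M_ R S n - I_ R S n)) <= d%:~R%:E)%E.
Proof.
move=> Sd.
have bS : bounded_past S by exists (S 0 + d) => m m0; have := Sd m 0 m0; lia.
have bfS : bounded_past (flip S).
  by exists (d - S 0) => m m0; have := Sd 0 (- m); rewrite /flip; lia.
have [[f Sf] [g Sg]] := (is_max_exists bS, is_max_exists bfS).
apply: ge_ereal_sup => _ [n _ <-].
rewrite -(opprK n) -M_flip (is_max_M R _ Sg) opprK (is_max_M R _ Sf).
rewrite -EFinD -intrD lee_fin ler_int.
have [_ [m mn <-]] := Sf n; have [_ [p pn <-]] := Sg (- n).
by have := Sd m (- p); rewrite /flip; lia.
Qed.

Lemma sup_MS_le S :
  (ereal_sup (range (fun n => M_ R S n - embed R S n)) <=
   ereal_sup (range (fun n => M_ R S n - I_ R S n)))%E.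
Proof.
apply: ge_ereal_sup => _ [n _ <-].
apply: (@le_trans _ _ (M_ R S n - I_ R S n)%E).
  by apply: leeB => //; apply: ereal_inf_lbound; exists n => /=.
by apply: ereal_sup_ubound; exists n.
Qed.

Lemma drop_le S (m p : int) : m <= p ->
  ((S m - S p)%:~R%:E <=
   ereal_sup (range (fun n => M_ R S n - embed R S n)) )%E.
Proof.
move=> mp; apply: (@le_trans _ _ (M_ R S p - embed R S p)%E).
  rewrite intrB EFinB leeB //; apply: ereal_sup_ubound; by exists m.
by apply: ereal_sup_ubound; exists p.
Qed.

(** Each drop is at most sup (M - S), and sup (M - I) is at most any bound on the drops. A D
    squeezed between the two suprema handles both at once. *)
Lemma oscillation_sup S (d : int) (D : \bar R) :
  (ereal_sup (range (fun n => M_ R S n - embed R S n)) <= D)%E ->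
  (D <= ereal_sup (range (fun n => M_ R S n - I_ R S n)))%E ->
  oscillation S d <-> D = d%:~R%:E.
Proof.
move=> D2 D1; have drop m p (mp : m <= p) := le_trans (drop_le S mp) D2.
split=> [[Sd [m [p [mp E]]]]|E].
  apply/eqP; rewrite eq_le (le_trans D1 (oscillation_le Sd)) -E; exact: drop.
split=> [m p /drop|]; first by rewrite E lee_fin ler_int.
apply: contrapT => H.
(* By integrality, if no drop equals d then all drops are at most d - 1. *)
have /oscillation_le : forall m p : int, m <= p -> S m - S p <= d - 1.
  move=> m p mp; have := drop m p mp; rewrite E lee_fin ler_int => Hd.
  have : S m - S p <> d by move=> e; apply: H; exists m, p.
  lia.
by move/(le_trans D1); rewrite E lee_fin ler_int; lia.
Qed.

Lemma oscillation_MI S (d : int) : oscillation S d <->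
  ereal_sup (range (fun n => M_ R S n - I_ R S n)%E) = d%:~R%:E.
Proof. by apply: oscillation_sup => //; exact: sup_MS_le. Qed.

Lemma oscillation_MS S (d : int) : oscillation S d <->
  ereal_sup (range (fun n => M_ R S n - embed R S n)%E) = d%:~R%:E.
Proof. by apply: oscillation_sup => //; exact: sup_MS_le. Qed.

Lemma oscillation_exists S :
  (ereal_sup (range (fun n => M_ R S n - embed R S n)) < +oo)%E ->
  exists d, oscillation S d.
Proof.
set D := ereal_sup _ => Doo.
have [r Dr] : exists r : R, (D <= r%:E)%E.
  by case: D Doo => // [r|] _; [exists r|exists 0; rewrite leNye].
have Sb (mp : int * int) : mp.1 <= mp.2 -> S mp.1 - S mp.2 <= Num.floor r.
  move=> /(drop_le S)/le_trans/(_ Dr); rewrite lee_fin.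
  by rewrite -floor_ge_int.
have [[m p] mp HS] := @int_max _ (fun mp : int * int => mp.1 <= mp.2)
  _ _ (0, 0) (lexx 0) Sb.
exists (S m - S p); split; last by exists m, p.
by move=> i j ij; exact: (HS (i, j)).
Qed.

Definition critical_toward s S := exists L l : int,
  [/\ limsup_seq (fun k => S (toward s k)) L,
      limsup_seq (fun k => - S (toward s k)) (- l) & oscillation S (L - l)].

Lemma critical_toward_plus S : critical_toward plus S <-> critical_end S.
Proof.
have P := limsup_seqP S; have PN := limsup_seqP (fun n => - S n).
split=> -[L [l [SL Sl SD]]]; exists L, l; split=> //.
- exact/P.
- exact/PN.
- exact/P.
- exact/PN.
Qed.

Lemma critical_toward_minus S :
  critical_toward minus S <-> critical_end (flip S).
Proof.
rewrite -critical_toward_plus.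
(* Reflection turns the pair (L, l) into (- l, - L), with the same difference. *)
split=> -[L [l [SL Sl SD]]]; exists (- l), (- L); split; rewrite ?opprK //.
- by move: SL; congr limsup_seq; apply/funext => k; rewrite /flip opprK.
- by rewrite addrC; exact: oscillation_flip.
- by move: Sl; congr limsup_seq; apply/funext => k; rewrite /flip opprK.
- by rewrite addrC -(flipK S); exact: oscillation_flip.
Qed.

Lemma toward_step S s k : paths0 S -> S (toward s k.+1) != S (toward s k).
Proof.
move=> pS; case: s => /=.
  have := pathsS (- k.+1%:Z) pS; rewrite (_ : - k.+1%:Z + 1 = - k%:Z); last lia.
  by move: (S _) (S _) => a b; lia.
have := pathsS k%:Z pS; rewrite (_ : k%:Z + 1 = k.+1%:Z); last lia.
by move: (S _) (S _) => a b; lia.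
Qed.

Lemma ScriticalP s S : Scritical R s S <-> paths0 S /\ critical_toward s S.
Proof.
split=> [[pS [K K0 [E1 E2]]]|[pS [L [l [SL Sl SD]]]]]; split=> //.
  have : (limsup R s S - liminf R s S)%E \is a fin_num by rewrite E2.
  rewrite fin_numB => /andP[/limsup_fin_num[L SL] /liminf_fin_num[l Sl]].
  exists L, l; split=> //; apply/oscillation_MI; rewrite E1.
  by rewrite (limsup_limsup_seq SL) (liminf_limsup_seq Sl) -EFinB -intrB.
have lL := limsup_seq_lt (fun k => toward_step s k pS) SL Sl.
have EL : (`|L - l|%N)%:R = (L - l)%:~R :> R.
  by rewrite pmulrn; congr (_%:~R); lia.
exists `|L - l|%N; first lia.
rewrite EL (limsup_limsup_seq SL) (liminf_limsup_seq Sl) -EFinB -intrB.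
split=> //; exact/oscillation_MI.
Qed.

Lemma critical_towardP s S :
  let D := ereal_sup (range (fun n => M_ R S n - embed R S n)%E) in
  critical_toward s S <-> [/\ (D < +oo)%E, limsup R s S = (liminf R s S + D)%E
    & limsup R s S \is a fin_num].
Proof.
move=> D; split=> [[L [l [SL Sl /oscillation_MS E]]]|[Doo E fL]].
  rewrite /D E (limsup_limsup_seq SL) (liminf_limsup_seq Sl) ltry; split=> //.
  by rewrite -EFinD -intrD addrC subrK.
have [d Sd] := oscillation_exists Doo; have Dd := (oscillation_MS _ _).1 Sd.
have [L SL] := limsup_fin_num fL.
(* A finite sum has finite terms, so the liminf is an integer as well. *)
have : (liminf R s S + D)%E \is a fin_num by rewrite -E.
rewrite fin_numD => /andP[/liminf_fin_num[l Sl] _].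
exists L, l; split=> //; suff -> : L - l = d by [].
move: E; rewrite /D Dd (limsup_limsup_seq SL) (liminf_limsup_seq Sl).
rewrite -EFinD -intrD.
by move=> [/intr_inj]; lia.
Qed.

Lemma asymptotic_flip S (F : int -> R) :
  asymptotic_to minus S F <-> asymptotic_to plus (flip S) (flip F).
Proof.
rewrite /asymptotic_to; suff -> :
  (fun k => (S (toward minus k))%:~R / F (toward minus k))
  = (fun k => (flip S (toward plus k))%:~R / flip F (toward plus k)) by [].
by apply/funext => k; rewrite /flip /= intrN invrN mulrNN.
Qed.

Lemma flip_increasing (F : int -> R) :
  strictly_increasing F -> strictly_increasing (flip F).
Proof. by move=> F_ m n mn; rewrite /flip ltrN2; apply: F_; rewrite ltrN2. Qed.

Lemma Ssub_critical_plus S :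
  Ssub_critical R plus S <-> paths0 S /\ sub_critical_end R S.
Proof.
by split=> -[pS [F F_ SF]]; split=> //; exists F => //;
  apply/(asymptoticP F_ pS).
Qed.

Lemma Ssub_critical_minus S :
  Ssub_critical R minus S <-> paths0 S /\ sub_critical_end R (flip S).
Proof.
split=> -[pS [F F_ SF]]; split=> //; exists (flip F);
  try exact: flip_increasing.
  apply/asymptoticP; [exact: flip_increasing|exact: flip_paths0|].
  exact/asymptotic_flip.
apply/asymptotic_flip; rewrite flipK.
by apply/asymptoticP => //; exact: flip_paths0.
Qed.

Lemma Sclass_plus S :
  (exists c, Sclass R c plus S) <-> paths0 S /\ regular_end R S.
Proof.
split=> [[[] /=]|[pS [sS|cS]]].
- by move=> /Ssub_critical_plus[pS sS]; split=> //; left.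
- by move=> /ScriticalP[pS /critical_toward_plus cS]; split=> //; right.
- by exists sub_critical; exact/Ssub_critical_plus.
- by exists critical; apply/ScriticalP; split=> //; exact/critical_toward_plus.
Qed.

Lemma Sclass_minus S :
  (exists c, Sclass R c minus S) <-> paths0 S /\ regular_end R (flip S).
Proof.
split=> [[[] /=]|[pS [sS|cS]]].
- by move=> /Ssub_critical_minus[pS sS]; split=> //; left.
- by move=> /ScriticalP[pS /critical_toward_minus cS]; split=> //; right.
- by exists sub_critical; exact/Ssub_critical_minus.
- by exists critical; apply/ScriticalP; split=> //; exact/critical_toward_minus.
Qed.

End extended.

Theorem theorem1p1 (R : realType) :
  (* (a) *)
  (forall S : int -> int, paths0 S ->
     [/\ cvgn (M_ R S \o toward plus), Moo R S = ereal_sup (range (embed R S)),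
         cvgn (I_ R S \o toward minus) & Ioo R S = ereal_inf (range (embed R S))])
  /\ Srev R =
    [set S | [/\ paths0 S, (M_ R S 0 < +oo)%E, (-oo < I_ R S 0)%E,
                 limsup R plus S = Moo R S & liminf R minus S = Ioo R S]]
  /\ (* (b) *)
  Sinv R =
    \bigcup_(c1 : regime) \bigcup_(c2 : regime)
      (Sclass R c1 minus `&` Sclass R c2 plus)
  /\ (forall s : sign,
     Scritical R s =
       [set S | let D := ereal_sup (range (fun n => M_ R S n - embed R S n)%E) in
                [/\ paths0 S, (D < +oo)%E, limsup R s S = (liminf R s S + D)%E
                  & limsup R s S \is a fin_num]])
  /\ (forall (s : sign) (F : int -> R) (S : int -> int),
     strictly_increasing F -> paths0 S -> asymptotic_to s S F ->
     match s with
     | plus => F (toward plus k) @[k --> \oo] --> +oo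
     | minus => F (toward minus k) @[k --> \oo] --> -oo
     end).
Proof.
have EM S : Moo R S = ereal_sup (range (embed R S))
  by apply: cvg_lim; [exact: ereal_hausdorff|exact: M_cvg].
have EI S : Ioo R S = ereal_inf (range (embed R S))
  by apply: cvg_lim; [exact: ereal_hausdorff|exact: I_cvg].
split; last split; last split; last split.
- by move=> S _; split=> //;
    [apply/cvg_ex; eexists; exact: M_cvg|apply/cvg_ex; eexists; exact: I_cvg].
- apply/seteqP; split=> S.
    move=> /SrevP[pS bS bfS rS rfS]; split=> //; first exact/M0_lty.
    + exact/I0_gtNy.
    + by rewrite EM; exact/limsup_recoversP.
    + by rewrite EI; exact/liminf_recoversP.
  move=> [pS /M0_lty bS /I0_gtNy bfS]; rewrite EM EI.
  by move=> /limsup_recoversP rS /liminf_recoversP rfS; exact/SrevP.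
- apply/seteqP; split=> S.
    move=> /SinvP[pS S1 S2].
    have [c2 H2] := (Sclass_plus _ _).2 (conj pS S1).
    have [c1 H1] := (Sclass_minus _ _).2 (conj pS S2).
    by exists c1 => //; exists c2.
  move=> [c1 _ [c2 _ [H1 H2]]]; apply/SinvP.
  have [pS S1] := (Sclass_plus R S).1 (ex_intro _ c2 H2).
  by have [_ S2] := (Sclass_minus R S).1 (ex_intro _ c1 H1).
- move=> s; apply/seteqP; split=> S.
    by move=> /ScriticalP[pS /(critical_towardP R)[? ? ?]].
  by move=> [pS ? ? ?]; apply/ScriticalP; split=> //;
    exact/(critical_towardP R).
- move=> [] F S F_ pS SF; last exact: asymptotic_plus_dvg SF.
  (* At -oo the reflected F is again strictly increasing and tends to +oo. *)
  have := asymptotic_plus_dvg (flip_increasing F_) (flip_paths0 pS)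
    ((asymptotic_flip _ _).1 SF).
  by move=> H; apply/cvgNry; exact: H.
Qed.
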